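(* Let $G$ be a topological group that contains an infinite precompact subset, and let $\pi$ be a measure preserving action of $G$ on a probability space $(X,\mu)$. Then $\operatorname{E}_\mu^{(nv)}(\pi)=0$.
   Context: Topological groups are assumed Hausdorff. A subset $A\subseteq G$ is precompact if for every neighbourhood $U$ of the neutral element there is a finite $F\subseteq G$ with $A\subseteq UF$. An action $\pi$ of a topological group $G$ on a probability space $(X,\mu)$, written $\pi^g(x)=g.x$, is measure preserving if (1) $\pi^g\colon X\to X$ is measurable for every $g\in G$; (2) $\mu(g.A)=\mu(A)$ for all $g\in G$ and measurable $A\subseteq X$; (3) for every measurable $A\subseteq X$ the map $G\to\mathbb{R}_{\geq 0}$, $g\mapsto\mu(A\triangle g.A)$ is continuous. For a finite measurable partition $\alpha$ of $X$ put $H_\mu(\alpha)=-\sum_{A\in\alpha,\ \mu(A)>0}\mu(A)\log\mu(A)$, and for a finite set $F\subseteq G$ let $\alpha_F=\{\bigcap_{g\in F}g^{-1}.A(g)\mid A\in\alpha^F\}$ (where $A\in \alpha^F$ ranges over all maps $F\to\alpha$). The naive entropy is $$\operatorname{E}_\mu^{(nv)}(\pi)=\sup_\alpha\inf_{F}\frac{H_\mu(\alpha_F)}{|F|},$$ the supremum being over all finite measurable partitions $\alpha$ of $X$ and the infimum over all non-empty finite subsets $F\subseteq G$. *)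

(* Defs.v *)
From HB Require Import structures.
From mathcomp Require Import all_boot all_order all_algebra finmap.
From mathcomp Require Import all_classical all_reals all_analysis.

Set Implicit Arguments.
Unset Strict Implicit.
Unset Printing Implicit Defensive.

Import Order.TTheory GRing.Theory Num.Theory.
Import numFieldNormedType.Exports.

Local Open Scope classical_set_scope.
Local Open Scope group_scope.
Local Open Scope ring_scope.

HB.structure Definition PreTopologicalGroup := {G of Topological G & Group G}.

HB.mixin Record PreTopologicalGroup_isTopologicalGroup G
    of PreTopologicalGroup G := {
  mulg_continuous : continuous (fun x : G * G => (x.1 * x.2)%g) ;
  invg_continuous : continuous (fun x : G => x^-1%g)
}.

(* No separation axiom is built in: hausdorff_space is assumed separately. *)
#[short(type="topologicalGroupType")]
HB.structure Definition TopologicalGroup :=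
  {G of PreTopologicalGroup_isTopologicalGroup G & PreTopologicalGroup G}.

(* Precompactness for the group uniformity; the library's [precompact] asks
   for a compact closure instead, which is stronger in general. *)
Definition group_precompact (G : topologicalGroupType) (A : set G) : Prop :=
  forall U : set G, nbhs (1%g : G) U ->
    exists F : {fset G}, A `<=` [set (u * f)%g | u in U & f in [set` F]].

Definition left_action (G : groupType) (X : Type) (pi : G -> X -> X) : Prop :=
  (forall x, pi 1%g x = x) /\
  (forall g h x, pi (g * h)%g x = pi g (pi h x)).

(* [fine] is harmless in the last clause, as [mu] only takes finite values. *)
Definition measure_preserving_action (R : realType) (d : measure_display)
    (X : measurableType d) (mu : probability X R)
    (G : topologicalGroupType) (pi : G -> X -> X) : Prop :=
  [/\ left_action pi,
      forall g, measurable_fun [set: X] (pi g),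
      forall g (A : set X), measurable A -> mu (pi g @` A) = mu A &
      forall A : set X, measurable A ->
        continuous (fun g : G => fine (mu (A `+` (pi g @` A))) : R)].

Definition finite_measurable_partition (d : measure_display)
    (X : measurableType d) (alpha : set (set X)) : Prop :=
  [/\ finite_set alpha,
      (forall A, alpha A -> measurable A) &
      partition alpha id [set: X]].

(* Meaningful for finite [alpha] only. Not restricted to partitions, since
   [refinement] below may contain the empty set. *)
Definition partition_entropy (R : realType) (d : measure_display)
    (X : measurableType d) (mu : probability X R) (alpha : set (set X)) : R :=
  - \sum_(A \in [set A | alpha A /\ (0 < mu A)%E])
      fine (mu A) * ln (fine (mu A)).

(* Maps F -> alpha are represented by total maps G -> set X whose values on F
   lie in [alpha]; the values outside F are irrelevant. *)
Definition refinement (G : groupType) (X : Type) (pi : G -> X -> X)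
    (alpha : set (set X)) (F : {fset G}) : set (set X) :=
  [set \bigcap_(g in [set` F]) (pi g^-1%g @` A g) |
     A in [set A : G -> set X | forall g, g \in F -> alpha (A g)]].

Definition naive_entropy (R : realType) (d : measure_display)
    (X : measurableType d) (mu : probability X R)
    (G : groupType) (pi : G -> X -> X) : \bar R :=
  ereal_sup
    [set ereal_inf
       [set (partition_entropy mu (refinement pi alpha F) / #|` F|%:R)%:E |
          F in [set F : {fset G} | F != fset0]] |
       alpha in [set alpha : set (set X) | finite_measurable_partition alpha]].

(* Main.v *)
(* Fix a finite measurable partition alpha with k cells, and a neighbourhood U
   of the identity such that mu (A `\` u^-1 A) is small for every cell A and
   every u in U. An infinite precompact set meets some right translate U e in
   an infinite set, which contains finite sets F of any cardinality n. For g in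
   F the cell of g x is, up to small probability, the cell of e x, so alpha_F is
   the joint law of n noisy copies of one random variable with k values. Gibbs'
   inequality bounds its entropy by ln k + n * eps, and dividing by n gives the
   claim. *)
Require Import Defs.
From mathcomp Require Import all_boot all_order all_algebra finmap.
From mathcomp Require Import all_classical all_reals all_analysis.
From mathcomp Require Import lra.

Set Implicit Arguments.
Unset Strict Implicit.
Unset Printing Implicit Defensive.

Import Order.TTheory GRing.Theory Num.Theory.

Local Open Scope classical_set_scope.
Local Open Scope ring_scope.

(** * Entropy of finite probability vectors *)

(** Termwise, [ln x <= x - 1] at [x = q t / p t], then summation. The mass of [q] may be smaller
    than that of [p], which suits the sub-probability used in [entropy_noisy_copies]. *)
Lemma gibbs_inequality (R : realType) (T : finType) (p q : T -> R) :
  (forall t, 0 <= p t) -> (forall t, 0 < q t) -> \sum_t q t <= \sum_t p t ->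
  - \sum_t p t * ln (p t) <= - \sum_t p t * ln (q t).
Proof.
move=> p0 q0 qp; rewrite lerN2 -subr_ge0 -sumrB.
have : \sum_t (p t - q t) <= \sum_t (p t * ln (p t) - p t * ln (q t)).
  apply: ler_sum => t _; have [->|pt] := eqVneq (p t) 0.
    by rewrite !mul0r !subr0 sub0r oppr_le0 ltW.
  have {}pt : 0 < p t by rewrite lt_neqAle eq_sym pt p0.
  rewrite -lerN2 !opprB -mulrBr -ln_div ?posrE//.
  have -> : q t - p t = p t * (q t / p t - 1).
    by rewrite mulrBr mulr1 mulrCA divff ?mulr1// gt_eqF.
  rewrite ler_wpM2l// -[X in ln X](subrKC 1) le_ln1Dx//.
  by rewrite ltrBrDl subrr divr_gt0.
by apply: le_trans; rewrite sumrB subr_ge0.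
Qed.

(* Compare with the output law [q] of a channel that, given [i] drawn uniformly
   from [I], independently for each [j] returns [i] with weight [1 - th] and
   every other letter with weight [th / #|I|]. *)
Lemma entropy_noisy_copies (R : realType) (I J : finType)
    (p : I * {ffun J -> I} -> R) (th delta : R) :
  0 < th -> th < 1 -> (forall t, 0 <= p t) -> \sum_t p t = 1 ->
  (forall j, \sum_(t : I * {ffun J -> I} | t.2 j != t.1) p t <= delta) ->
  - \sum_f (\sum_i p (i, f)) * ln (\sum_i p (i, f)) <=
    ln #|I|%:R + #|J|%:R * (delta * ln (#|I|%:R / th) - ln (1 - th)).
Proof.
move=> th0 th1 p0 p1 pd; set k : R := #|I|%:R.
have k1 : 1 <= k.
  rewrite ler1n lt0n; apply/negP => /eqP/fintype0 I0.
  suff : \sum_t p t = 0 by move/eqP; rewrite p1 oner_eq0.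
  by rewrite big1// => -[i]; have := I0 i.
have k0 : 0 < k by rewrite (lt_le_trans ltr01).
have th1' : 0 < 1 - th by rewrite subr_gt0.
have thk0 : 0 < th / k by rewrite divr_gt0.
pose r (i a : I) : R := if a == i then 1 - th else th / k.
have r0 i a : 0 < r i a by rewrite /r; case: ifP.
(* The weights fall short of 1 by [th / k], since the letter [i] itself does not receive this share;
   adding it gives a bound that sums to exactly 1. *)
have rsum i : \sum_a r i a <= 1.
  apply: (@le_trans _ _ (\sum_a ((a == i)%:R * (1 - th) + th / k))).
    apply: ler_sum => a _; rewrite /r; case: ifP => _.
      by rewrite mul1r lerDl ltW.
    by rewrite mul0r add0r.
  rewrite big_split/= -mulr_suml (bigD1 i)//= eqxx.
  rewrite big1 => [|a /negPf-> //]; rewrite addr0 mul1r.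
  by rewrite sumr_const -[X in _ + X]mulr_natr divfK ?gt_eqF// subrK.
pose w i (f : {ffun J -> I}) := k^-1 * \prod_j r i (f j).
have w0 i f : 0 < w i f by rewrite mulr_gt0 ?invr_gt0// prodr_gt0.
pose q f := \sum_i w i f.
have wq i f : w i f <= q f.
  by rewrite /q (bigD1 i)//= lerDl sumr_ge0// => j _; rewrite ltW.
have [i0 _] : exists i0 : I, i0 \in I.
  by apply/card_gt0P; rewrite -(ltr_nat R).
have q0 f : 0 < q f by rewrite (lt_le_trans (w0 i0 f)).
have qsum : \sum_f q f <= 1.
  have -> : 1 = \sum_(i : I) k^-1.
    by rewrite sumr_const -mulr_natl divff ?gt_eqF.
  rewrite exchange_big/=; apply: ler_sum => i _; rewrite -mulr_sumr mulrC.
  rewrite ler_piMl ?invr_ge0 ?(ltW k0)//.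
  have -> : \sum_(f : {ffun J -> I}) \prod_j r i (f j) =
      \prod_(j : J) \sum_a r i a.
    by rewrite bigA_distr_bigA.
  by apply: prodr_ile1 => j _; rewrite rsum sumr_ge0// => a _; rewrite ltW.
have Psum : \sum_f \sum_i p (i, f) = 1.
  by rewrite exchange_big -p1 pair_big; apply: eq_bigr => -[].
have := @gibbs_inequality R _ (fun f => \sum_i p (i, f)) q
  (fun f => sumr_ge0 _ (fun i _ => p0 _)) q0.
rewrite Psum => /(_ qsum)/le_trans; apply.
pose A := - ln (1 - th); pose B := ln (k / th).
have B0 : 0 <= B.
  by rewrite ln_ge0// ler_pdivlMr// mul1r (le_trans (ltW th1)).
(* Only the summand [w i f] of [q f] is kept. The uniform letter costs [ln k], an agreeing
   coordinate costs [A], and a disagreeing one costs [B], enlarged to [A + B]. *)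
have lnq i f : - ln (q f) <= ln k + \sum_j (A + (f j != i)%:R * B).
  apply: (@le_trans _ _ (- ln (w i f))).
    by rewrite lerN2 ler_ln ?posrE.
  rewrite /w lnM ?posrE ?invr_gt0 ?prodr_gt0// lnV ?posrE// opprD opprK lerD2l.
  suff -> : ln (\prod_j r i (f j)) = \sum_j ln (r i (f j)).
    rewrite -sumrN; apply: ler_sum => j _; rewrite /r /A /B.
    case: eqVneq => _ /=; first by rewrite mul0r addr0.
    rewrite mul1r -[k / th]invf_div lnV ?posrE// lerDr oppr_ge0 ln_le0//.
    by rewrite lerBlDl lerDr ltW.
  (* Positivity of the partial products is carried through the induction because [lnM] requires
     it. *)
  have [] // : \sum_j ln (r i (f j)) = ln (\prod_j r i (f j)) /\
    0 < \prod_j r i (f j).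
  apply: (big_rec2 (fun x y => x = ln y /\ 0 < y)).
    by rewrite ln1 ltr01.
  by move=> j x y _ [-> y0]; rewrite lnM ?posrE// mulr_gt0.
(* The bound [lnq] holds for every [i], so it can be averaged over the joint law [p]; then [B] is
   weighted only by the probability of disagreement. *)
apply: (@le_trans _ _
    (\sum_t p t * (ln k + \sum_j (A + (t.2 j != t.1)%:R * B)))).
  rewrite -sumrN.
  under eq_bigr do rewrite mulr_suml -sumrN.
  rewrite exchange_big pair_big; apply: ler_sum => -[i f] _ /=.
  by rewrite -mulrN ler_wpM2l.
under eq_bigr do rewrite mulrDr mulr_sumr.
rewrite big_split/= -mulr_suml p1 mul1r lerD2l exchange_big/=.
rewrite mulr_natl -sumr_const; apply: ler_sum => j _.
under eq_bigr do rewrite mulrDr mulrA.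
rewrite big_split/= -!mulr_suml p1 mul1r addrC lerD2r ler_wpM2r//.
apply: le_trans (pd j); rewrite [leRHS]big_mkcond/=.
by apply: ler_sum => t _; case: ifP => _; rewrite ?mulr1 ?mulr0.
Qed.

(** * Partitions as fibers of maps to finite types *)

Lemma partition_entropy_ge0 (R : realType) (d : measure_display)
    (X : measurableType d) (mu : probability X R) (beta : set (set X)) :
  (forall A, beta A -> measurable A) -> 0 <= partition_entropy mu beta.
Proof.
move=> mbeta; rewrite oppr_ge0 fsumr_le0// => A [/mbeta mA _].
rewrite mulr_ge0_le0 ?fine_ge0// ln_le0//.
by rewrite -lee_fin fineK ?fin_num_measure// probability_le1.
Qed.

Lemma fine_measure_fibers (R : realType) (d : measure_display)
    (X : measurableType d) (mu : probability X R) (T : finType) (z : X -> T)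
    (B : pred T) :
  (forall t, measurable (z @^-1` [set t])) ->
  fine (mu (z @^-1` [set t | B t])) =
    \sum_(t | B t) fine (mu (z @^-1` [set t])).
Proof.
move=> mz.
have -> : z @^-1` [set t | B t] = \bigcup_(t in [set t | B t]) z @^-1` [set t].
  by apply/seteqP; split=> [x Bx|x [t Bt /= ->]//]; exists (z x).
rewrite measure_fin_bigcup//=; last first.
  by move=> t u _ _ [x [/= <- <-]].
rewrite (fsbigE (enum B)) ?enum_uniq//=; first last.
- by move=> t Bt; rewrite mem_enum => /negP.
- by move=> t /=; rewrite mem_enum.
rewrite sum_fine => [|t _]; last exact: fin_num_measure.
rewrite big_enum_cond; congr fine; apply: eq_bigl => t.
by rewrite andb_idr// => Bt; rewrite inE.
Qed.

(** A fiber of positive measure contains a point and hence determines its label, so the sum over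
    sets can be reindexed by labels. Null fibers contribute zero, and empty members of [beta] are
    already excluded by the positivity condition. *)
Lemma partition_entropy_fibers (R : realType) (d : measure_display)
    (X : measurableType d) (mu : probability X R) (T : finType) (y : X -> T)
    (beta : set (set X)) :
  (forall t, beta (y @^-1` [set t])) ->
  (forall A, beta A -> A !=set0 -> exists t, A = y @^-1` [set t]) ->
  partition_entropy mu beta =
    - \sum_t fine (mu (y @^-1` [set t])) * ln (fine (mu (y @^-1` [set t]))).
Proof.
move=> ybeta betay; rewrite /partition_entropy; congr (- _).
have -> : [set A | beta A /\ (0 < mu A)%E] =
    (fun t => y @^-1` [set t]) @` [set t | (0 < mu (y @^-1` [set t]))%E].
  apply/seteqP; split=> [A [bA muA]|_ [t mut <-]//].
  have [|t At] := betay _ bA; last by exists t; rewrite //= -At.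
  by apply/set0P/eqP => A0; move: muA; rewrite A0 measure0 ltxx.
rewrite fsbig_image => [|t u]; last first.
  rewrite !inE/= => mut _ tu.
  have /set0P[x xt] : y @^-1` [set t] != set0.
    by apply/eqP => t0; move: mut; rewrite t0 measure0 ltxx.
  by have xu := xt; rewrite tu in xu; rewrite -[LHS]xt.
rewrite (fsbig_widen _ setT)//; last first.
  move=> t [_ /= /negP]; rewrite -leNgt => mut0.
  by rewrite (_ : mu _ = 0%E) ?mul0r//; apply/le_anti; rewrite mut0/=.
rewrite (fsbigE (index_enum T)) ?index_enum_uniq//=; last first.
  by move=> t _; rewrite mem_index_enum.
by apply: eq_bigl => t; rewrite in_setT.
Qed.

(** Covering provides a cell around each point, and disjointness makes the fiber of a label the
    whole cell. *)
Lemma finite_measurable_partition_label (d : measure_display)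
    (X : measurableType d) (alpha : set (set X)) :
  finite_measurable_partition alpha ->
  exists c : X -> fset_set alpha, forall i, c @^-1` [set i] = val i.
Proof.
move=> [fin_alpha _ [cover_alpha triv_alpha _]].
have : forall x, exists i : fset_set alpha, val i x.
  move=> x; have [A aA Ax] : cover alpha id x by rewrite cover_alpha.
  have iA : A \in fset_set alpha by rewrite in_fset_set// inE.
  by exists [` iA]%fset.
move=> /choice[c cP]; exists c => i; apply/seteqP; split=> [x <- //|x ix].
have alphaP (j : fset_set alpha) : alpha (val j).
  by have := valP j; rewrite in_fset_set// inE.
by apply/val_inj/(triv_alpha _ _ (alphaP _) (alphaP _)); exists x.
Qed.

Lemma left_action_image_inv (G : groupType) (X : Type) (pi : G -> X -> X)
    (g : G) (A : set X) :
  left_action pi -> pi g^-1%g @` A = pi g @^-1` A.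
Proof.
move=> [pi1 piM]; apply/seteqP; split=> [_ [x Ax <-]|x Ax] /=.
  by rewrite -piM mulgV pi1.
by exists (pi g x); rewrite // -piM mulVg pi1.
Qed.

Lemma measurable_fset_set (d : measure_display) (X : measurableType d)
    (alpha : set (set X)) (i : fset_set alpha) :
  finite_measurable_partition alpha -> measurable (val i).
Proof.
move=> [fin_alpha malpha _]; apply: malpha.
by have := valP i; rewrite in_fset_set// inE.
Qed.

(** The map [y] records the word of cells visited by a point along [F]. A nonempty intersection of
    translated cells is the fiber over the word of any of its points. *)
Lemma refinement_fibers (G : groupType) (X : Type) (pi : G -> X -> X)
    (alpha : set (set X)) (c : X -> fset_set alpha) (F : {fset G})
    (y := fun x => [ffun g : F => c (pi (val g) x)]) :
  left_action pi -> finite_set alpha ->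
  (forall i, c @^-1` [set i] = val i) ->
  (forall f, refinement pi alpha F (y @^-1` [set f])) /\
  (forall A, refinement pi alpha F A -> A !=set0 ->
    exists f, A = y @^-1` [set f]).
Proof.
move=> pi_act fin_alpha cE.
have cP x i : val i x <-> c x = i by rewrite -cE.
have alphaP (j : fset_set alpha) : alpha (val j).
  by have := valP j; rewrite in_fset_set// inE.
split=> [f|_ [A FA <-] [x0 x0A]].
  (* The default [set0] is taken only outside [F], where the value is irrelevant. *)
  exists (fun g => oapp (fun h : F => val (f h)) set0 (insub g)).
    by move=> g gF; rewrite insubT; exact: alphaP.
  apply/seteqP; split=> [x xf|x /= <- g gF].
    apply/ffunP => h; rewrite ffunE; apply/cP.
    have := xf (val h) (valP h); rewrite left_action_image_inv//=.
    by rewrite valK.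
  by rewrite left_action_image_inv//= insubT/= ffunE; apply/cP.
exists (y x0); apply/seteqP; split=> [x xA|x /= yx g gF].
  apply/ffunP => h; rewrite !ffunE; apply/cP.
  have := xA _ (valP h); have := x0A _ (valP h).
  have hA : A (val h) \in fset_set alpha.
    by rewrite in_fset_set// inE; apply: FA; exact: valP.
  rewrite !left_action_image_inv//=.
  by move=> /(cP _ [` hA]%fset) ->.
have := x0A _ gF; rewrite !left_action_image_inv//=.
have gA : A g \in fset_set alpha by rewrite in_fset_set// inE; exact: FA.
move=> /(cP _ [` gA]%fset) cx0; apply/(cP _ [` gA]%fset).
by move/ffunP: yx => /(_ [` gF]%fset); rewrite !ffunE/= cx0.
Qed.

(** The law of [z], which pairs the reference label at [pi e x] with the word [y x], is fed to
    [entropy_noisy_copies]; its marginal on words gives the entropy of the refinement. *)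
Lemma refinement_entropy_le (R : realType) (d : measure_display)
    (X : measurableType d) (mu : probability X R) (G : groupType)
    (pi : G -> X -> X) (alpha : set (set X)) (c : X -> fset_set alpha)
    (F : {fset G}) (e : G) (th delta : R) :
  left_action pi -> (forall g, measurable_fun [set: X] (pi g)) ->
  finite_measurable_partition alpha ->
  (forall i, c @^-1` [set i] = val i) -> 0 < th -> th < 1 ->
  (forall g, g \in F ->
    fine (mu [set x | c (pi g x) != c (pi e x)]) <= delta) ->
  partition_entropy mu (refinement pi alpha F) <=
    ln #|` fset_set alpha|%:R +
    #|` F|%:R * (delta * ln (#|` fset_set alpha|%:R / th) - ln (1 - th)).
Proof.
move=> pi_act mpi alphaP cE th0 th1 Fdelta.
have [fin_alpha _ _] := alphaP.
pose y x := [ffun g : F => c (pi (val g) x)].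
have mc g i : measurable ((fun x => c (pi g x)) @^-1` [set i]).
  rewrite -[X in measurable X]setTI.
  have -> : (fun x => c (pi g x)) @^-1` [set i] = pi g @^-1` val i.
    by rewrite -cE.
  by apply: mpi => //; exact: measurable_fset_set.
have my f : measurable (y @^-1` [set f]).
  have -> : y @^-1` [set f] = \bigcap_(g in [set: F])
      (fun x => c (pi (val g) x)) @^-1` [set f g].
    apply/seteqP; split=> [x /= <- g _ /=|x xf]; first by rewrite ffunE.
    by apply/ffunP => g; rewrite ffunE; exact: xf.
  exact: fin_bigcap_measurable.
pose z x := (c (pi e x), y x).
have mz t : measurable (z @^-1` [set t]).
  have -> : z @^-1` [set t] =
      (fun x => c (pi e x)) @^-1` [set t.1] `&` y @^-1` [set t.2].
    by case: t => i f; apply/seteqP; split=> x /= [<- <-].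
  exact: measurableI.
have [yref refy] := @refinement_fibers _ _ pi alpha c F pi_act fin_alpha cE.
rewrite (partition_entropy_fibers _ yref refy).
have yz f : fine (mu (y @^-1` [set f])) =
    \sum_i fine (mu (z @^-1` [set (i, f)])).
  have -> : y @^-1` [set f] = z @^-1` [set t | t.2 == f].
    by apply/seteqP; split=> [x /= ->|x /= /eqP].
  rewrite (fine_measure_fibers mu (fun t : _ * {ffun F -> _} => t.2 == f))//.
  rewrite (reindex (fun i => (i, f)))/=.
    by apply: eq_bigl => i; rewrite eqxx.
  by exists fst => [//|[i f'] /eqP/= ->].
under eq_bigr do rewrite yz.
rewrite !cardfE.
pose p t := fine (mu (z @^-1` [set t])).
apply: (entropy_noisy_copies (p := p)) => // [t||g]; rewrite /p.
- exact: fine_ge0.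
- rewrite -(fine_measure_fibers mu xpredT)//.
  by rewrite (_ : _ @^-1` _ = setT) ?probability_setT//; apply/seteqP; split.
- apply: le_trans (Fdelta _ (valP g)).
  rewrite -(fine_measure_fibers mu
    (fun t : _ * {ffun F -> _} => t.2 g != t.1))//.
  rewrite le_eqVlt; apply/orP; left; apply/eqP; congr (fine (mu _)).
  by apply/seteqP; split=> x /=; rewrite ffunE.
Qed.

(** * Small displacement of cells near the identity *)

Lemma measurable_action_preimage (R : realType) (d : measure_display)
    (X : measurableType d) (mu : probability X R) (G : topologicalGroupType)
    (pi : G -> X -> X) g (A : set X) :
  measure_preserving_action mu pi ->
  measurable A -> measurable (pi g @^-1` A).
Proof.
move=> [_ mpi _ _] mA; rewrite -[X in measurable X]setTI.
exact: mpi.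
Qed.

Lemma measure_action_preimage (R : realType) (d : measure_display)
    (X : measurableType d) (mu : probability X R) (G : topologicalGroupType)
    (pi : G -> X -> X) g (A : set X) :
  measure_preserving_action mu pi ->
  measurable A -> mu (pi g @^-1` A) = mu A.
Proof.
move=> [act _ pres _] mA.
by rewrite -left_action_image_inv// pres.
Qed.

(** The map [pi u] preserves measure and sends the points of [A] that leave [A] into the symmetric
    difference of [A] and its image, whose measure is continuous in [u] and vanishes at the
    identity. *)
Lemma near_measure_setD_action (R : realType) (d : measure_display)
    (X : measurableType d) (mu : probability X R) (G : topologicalGroupType)
    (pi : G -> X -> X)
    (A : set X) (delta : R) :
  measure_preserving_action mu pi ->
  measurable A -> 0 < delta ->
  \forall u \near (1%g : G), fine (mu (A `\` pi u @^-1` A)) < delta.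
Proof.
move=> pi_mpa mA delta0; case: (pi_mpa) => act _ pres pi_cont.
have mD u : measurable (A `\` pi u @^-1` A).
  by apply: measurableD => //; exact: measurable_action_preimage pi_mpa _.
have piA u : pi u @` A = pi u^-1%g @^-1` A.
  by rewrite -left_action_image_inv// invgK.
have mY u : measurable (A `+` (pi u @` A)).
  have mpiA : measurable (pi u @` A).
    by rewrite piA; exact: measurable_action_preimage pi_mpa _.
  by apply: measurableU; exact: measurableD.
have := pi_cont A mA 1%g; rewrite /continuous_at.
have -> : pi 1%g @` A = A.
  by rewrite piA; apply/seteqP; split=> x; rewrite /= invg1 act.1.
rewrite setYK measure0 => /cvgr_lt/(_ _ delta0); apply: filterS => u.
apply: le_lt_trans; apply: fine_le; rewrite ?fin_num_measure//.
rewrite -(pres u)//; apply: le_measure; rewrite ?inE//.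
- by rewrite -[u]invgK left_action_image_inv//;
    exact: measurable_action_preimage pi_mpa _.
- by move=> _ [x [Ax nAx] <-]; right; split=> //; exists x.
Qed.

(** The labels differ exactly when [u] moves [pi e x] out of its cell. This event is the union over
    the cells of preimages under [pi e], each of measure at most [delta] by invariance. It matters
    that [e] stands on the right of [u]. *)
Lemma measure_label_neq (R : realType) (d : measure_display)
    (X : measurableType d) (mu : probability X R) (G : topologicalGroupType)
    (pi : G -> X -> X)
    (alpha : set (set X)) (c : X -> fset_set alpha)
    (u e : G) (delta : R) :
  measure_preserving_action mu pi -> finite_measurable_partition alpha ->
  (forall i, c @^-1` [set i] = val i) ->
  (forall i : fset_set alpha,
    fine (mu (val i `\` pi u @^-1` val i)) <= delta) ->
  fine (mu [set x | c (pi (u * e)%g x) != c (pi e x)]) <=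
    #|` fset_set alpha|%:R * delta.
Proof.
move=> pi_mpa alphaP cE udelta; case: (pi_mpa) => act mpi pres _.
have mval i := measurable_fset_set i alphaP.
have mD (i : fset_set alpha) : measurable (val i `\` pi u @^-1` val i).
  apply: measurableD => //.
  exact: measurable_action_preimage pi_mpa (mval i).
set E := [set x | _].
have EE : E = \bigcup_(i in [set: fset_set alpha])
    pi e @^-1` (val i `\` pi u @^-1` val i).
  apply/seteqP; split=> [x /eqP Ex|x [i _ []]].
    exists (c (pi e x)) => //=; rewrite -!cE/= -act.2.
    by split=> // /eqP; rewrite act.2.
  by rewrite -!cE/= -act.2 => <- /eqP.
have mE : measurable E.
  rewrite EE; apply: fin_bigcup_measurable => // i _.
  exact: measurable_action_preimage pi_mpa (mD i).
rewrite -lee_fin fineK ?fin_num_measure//.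
apply: (le_trans (content_sub_fsum (D := [set: fset_set alpha])
    (A_ := fun i => pi e @^-1` (val i `\` pi u @^-1` val i)) mu _ _ mE _)).
- exact: finite_finset.
- by move=> i _; exact: measurable_action_preimage pi_mpa (mD i).
- by rewrite EE.
rewrite (fsbigE (index_enum _)) ?index_enum_uniq//=; last first.
  by move=> t _; rewrite mem_index_enum.
apply: (@le_trans _ _ (\sum_(i : fset_set alpha) delta%:E)%E).
  rewrite [leLHS](eq_bigl xpredT) => [|i]; last by rewrite in_setT.
  apply: lee_sum => i _; rewrite (measure_action_preimage _ pi_mpa (mD i)).
  by rewrite -[leLHS]fineK ?fin_num_measure// lee_fin.
by rewrite sumEFin lee_fin sumr_const cardfE mulr_natl.
Qed.


(** * From precompactness to vanishing entropy *)

(** Pigeonhole: finitely many right translates of [U] cover [A], so they cannot all meet it in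
    finite sets. *)
Lemma infinite_precompact_coset (G : topologicalGroupType) (A U : set G) :
  infinite_set A -> group_precompact A -> nbhs (1%g : G) U ->
  exists e : G, infinite_set (A `&` [set (u * e)%g | u in U]).
Proof.
move=> infA preA /preA[E AE]; apply: contrapT => /forallNP finE; apply: infA.
apply: (@sub_finite_set _ _
    (\bigcup_(e in [set` E]) (A `&` [set (u * e)%g | u in U]))).
  move=> x Ax; have [u Uu [e Ee uex]] := AE x Ax.
  by exists e => //; split=> //; exists u.
by apply: bigcup_finite => // e _; apply: contrapT; exact: finE.
Qed.

Lemma measurable_refinement (R : realType) (d : measure_display)
    (X : measurableType d) (mu : probability X R) (G : topologicalGroupType)
    (pi : G -> X -> X) (alpha : set (set X)) (F : {fset G}) (B : set X) :
  measure_preserving_action mu pi -> finite_measurable_partition alpha ->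
  refinement pi alpha F B -> measurable B.
Proof.
move=> pi_mpa [_ malpha _] [A FA <-]; have [act _ _ _] := pi_mpa.
apply: fin_bigcap_measurable => // g /FA/malpha mA.
by rewrite left_action_image_inv//; exact: measurable_action_preimage pi_mpa mA.
Qed.

(** The rate is at most [ln k / n + k * delta * L - ln (1 - th)], where [n] is the size of [F]; each
    of the three terms is made at most [eps / 3]. *)
Lemma refinement_entropy_rate_small (R : realType) (d : measure_display)
    (X : measurableType d) (mu : probability X R) (G : topologicalGroupType)
    (pi : G -> X -> X) (A : set G) (alpha : set (set X)) (eps : R) :
  infinite_set A -> group_precompact A -> measure_preserving_action mu pi ->
  finite_measurable_partition alpha -> 0 < eps ->
  exists2 F : {fset G}, F != fset0 &
    partition_entropy mu (refinement pi alpha F) / #|` F|%:R <= eps.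
Proof.
move=> infA preA pi_mpa alphaP eps0; have [act mpi _ _] := pi_mpa.
have [c cE] := finite_measurable_partition_label alphaP.
set k := #|` fset_set alpha|.
have eps3 : 0 < eps / 3 by rewrite divr_gt0.
(* Chosen so that [- ln (1 - th)] equals [eps / 3]. *)
pose th := 1 - expR (- (eps / 3)).
have th0 : 0 < th by rewrite subr_gt0 expR_lt1 oppr_lt0.
have th1 : th < 1 by rewrite ltrBlDr ltrDl expR_gt0.
pose L := ln (k%:R / th).
(* Bound per cell; summing over the [k] cells gives mismatch [k * delta]. The denominator is
   positive whatever [k] and the sign of [L]. *)
pose delta := eps / 3 / (k%:R * (`|L| + 1) + 1).
have kL0 : 0 <= k%:R * (`|L| + 1) by rewrite mulr_ge0// addr_ge0.
have delta0 : 0 < delta by rewrite divr_gt0// ltr_wpDl.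
have deltaL : k%:R * delta * L <= eps / 3.
  apply: (@le_trans _ _ (k%:R * (`|L| + 1) * delta)).
    rewrite mulrAC ler_wpM2r ?(ltW delta0)// ler_wpM2l//.
    by rewrite (le_trans (ler_norm L))// lerDl.
  rewrite mulrCA ger_pMr// ler_pdivrMr ?ltr_wpDl// mul1r.
  by rewrite lerDl.
have nearU : \forall u \near (1%g : G), forall i : fset_set alpha,
    fine (mu (val i `\` pi u @^-1` val i)) < delta.
  apply: filter_forall => i.
  exact: near_measure_setD_action pi_mpa (measurable_fset_set i alphaP) delta0.
(* The successor makes the size of [F] exceed [ln k / (eps / 3)] and also makes [F] nonempty. *)
have [e /(infinite_set_fset (Num.truncn (ln k%:R / (eps / 3))).+1)] :=
  infinite_precompact_coset infA preA nearU.
move=> [F FU Fn].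
have F0 : (0 < #|` F|)%N by rewrite (leq_trans _ Fn).
exists F; first by rewrite -cardfs_gt0.
have Fdelta g : g \in F ->
    fine (mu [set x | c (pi g x) != c (pi e x)]) <= k%:R * delta.
  move=> /FU[_ [u Uu <-]]; apply: (measure_label_neq (c := c)) => // i.
  exact/ltW/Uu.
have := refinement_entropy_le act mpi alphaP cE th0 th1 Fdelta.
have n0 : 0 < #|` F|%:R :> R by rewrite ltr0n.
rewrite ler_pdivrMr// => /le_trans; apply.
have lnth : - ln (1 - th) = eps / 3 by rewrite subKr expRK opprK.
rewrite -/k -/L lnth.
have lnk : ln k%:R <= #|` F|%:R * (eps / 3).
  rewrite -ler_pdivrMr//; apply: ltW.
  by rewrite (lt_le_trans (truncnS_gt _))// ler_nat.
apply: (@le_trans _ _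
    (#|` F|%:R * (eps / 3) + #|` F|%:R * (eps / 3 + eps / 3))).
  by rewrite lerD// ler_wpM2l// lerD2r.
by rewrite -mulrDr mulrC ler_wpM2r//; lra.
Qed.

Theorem corollary6p8 (R : realType) (d : measure_display)
    (X : measurableType d) (mu : probability X R)
    (G : topologicalGroupType) (pi : G -> X -> X) :
  hausdorff_space G ->
  (exists A : set G, infinite_set A /\ group_precompact A) ->
  measure_preserving_action mu pi ->
  naive_entropy mu pi = 0%E.
Proof.
move=> _ [A [infA preA]] pi_mpa; apply/le_anti/andP; split.
  apply: ge_ereal_sup => _ [alpha alphaP <-].
  apply/lee_addgt0Pr => eps eps0; rewrite add0e; apply: ge_ereal_inf.
  have [F F0 Feps] :=
    refinement_entropy_rate_small infA preA pi_mpa alphaP eps0.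
  by exists (partition_entropy mu (refinement pi alpha F) / #|` F|%:R)%:E;
    [exists F | rewrite lee_fin].
(* For the lower bound the supremum must range over at least one partition; the one-cell partition
   qualifies, as total mass 1 forces [X] to be nonempty. *)
have trivP : finite_measurable_partition [set [set: X]].
  split=> [|_ ->//|]; first exact: finite_set1.
  split=> [|_ _ -> ->//|_ ->]; first by rewrite /cover bigcup_set1.
  apply/set0P/eqP => X0; have := probability_setT mu.
  by rewrite X0 measure0 => /esym/eqP; rewrite onee_eq0.
apply: ereal_sup_ge; eexists; first by exists [set [set: X]].
apply: le_ereal_inf_tmp => _ [F _ <-]; rewrite lee_fin divr_ge0//.
apply: partition_entropy_ge0 => B.
exact: measurable_refinement pi_mpa trivP.
Qed.
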